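(* Let $(X,\mathsf d)$ be a complete, proper and separable metric space. Fix $\bar x\in X$ and assume the existence of a pointed, proper, complete and separable metric space $(X_\infty,\mathsf d_\infty,\bar x_\infty)\in\mathrm{Tan}(X,\mathsf d,\bar x)$. Let $\gamma\in\Gamma(X)$ be such that $\gamma_0=\bar x$, $0$ is a point of density one of $\mathrm{Dom}(\gamma)$, and $\gamma$ is metric differentiable at $0$ with $|d\gamma|(0)>0$. Then $(X_\infty,\mathsf d_\infty,\bar x_\infty)$ contains a line (an isometric copy of $\mathbb R$) which is a limit of $\gamma$.
   Context: $\Gamma(X)$ is the set of biLipschitz maps $\gamma\colon\mathrm{Dom}(\gamma)\to X$ with $\mathrm{Dom}(\gamma)\subset\mathbb R$ non-empty and compact; $\gamma_t:=\gamma(t)$. Tangents: a map $f\colon (A,\mathsf d_A)\to (B,\mathsf d_B)$ is an $\varepsilon$-isometry if $|\mathsf d_A(z,w)-\mathsf d_B(f(z),f(w))|\le\varepsilon$ for all $z,w\in A$ and for every $b\in B$ there is $a\in A$ with $\mathsf d_B(f(a),b)\le\varepsilon$. Pointed proper complete metric spaces $(X_i,\mathsf d_i,\bar x_i)$ converge in the pGH sense to a pointed proper complete metric space $(X_\infty,\mathsf d_\infty,\bar x_\infty)$ if there are $\varepsilon_i\to0$, $R_i\to\infty$ and $\varepsilon_i$-isometries $f_i\colon B^{X_i}_{R_i}(\bar x_i)\to B^{X_\infty}_{R_i}(\bar x_\infty)$ with $f_i(\bar x_i)=\bar x_\infty$. $\mathrm{Tan}(X,\mathsf d,\bar x)$ is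 the set of all pGH limits of sequences $(X,\mathsf d/r_i,\bar x)$ with $r_i>0$, $r_i\to0$. Metric differentiability: Borel sets $E_i\subset\mathbb R$ shrink nicely to $t$ if there are $r_i>0$ and $\alpha>0$ with $E_i\subset B_{r_i}(t)$ and $\mathcal L^1(E_i)\ge\alpha\,\mathcal L^1(B_{r_i}(t))$ for all $i$. A curve $\gamma$ is metric differentiable at $t\in\mathrm{Dom}(\gamma)$ if the limit of $\mathsf d(\gamma_{t+s},\gamma_{t+\tau})/|s-\tau|$ exists along all sequences $s,\tau\to0$ with $t+s,t+\tau\in\mathrm{Dom}(\gamma)$ such that the intervals with endpoints $t+s$ and $t+\tau$ shrink nicely to $t$; the common limit is denoted $|d\gamma|(t)$. Limit of a curve: a line in $X_\infty$ is a limit of $\gamma$ if it is the image of a map $\lambda\colon\mathbb R\to X_\infty$ with $\mathsf d_\infty(\lambda(t),\lambda(s))=c|t-s|$ for some $c>0$ and all $s,t$, for which there are $r_i\to0$ and $\varepsilon_i$-isometries $f_i$ realizing the pGH convergence $(X,\mathsf d/r_i,\bar x)\to(X_\infty,\mathsf d_\infty,\bar x_\infty)$, and a dense set $D\subset\mathbb R$, such that for each $t\in D$ one has $r_it\in\mathrm{Dom}(\gamma)$ for all large $i$ and $\lambda(t)=\lim_{i\to\infty}f_i(\gamma_{r_it})$. *)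

(* Defs.v *)
From HB Require Import structures.
From mathcomp Require Import all_boot all_order all_algebra.
From mathcomp Require Import all_classical all_reals all_analysis.

Set Implicit Arguments.
Unset Strict Implicit.
Unset Printing Implicit Defensive.

Import Order.TTheory GRing.Theory Num.Theory.
Import numFieldNormedType.Exports.

Local Open Scope classical_set_scope.
Local Open Scope ring_scope.

Section MetricSpaces.
Variables (R : realType) (X : metricType R).

(* Cauchy filters rather than sequences; no base point is needed. *)
Definition complete_space : Prop :=
  forall F : set_system X, ProperFilter F -> cauchy F -> exists x : X, F --> x.

Definition proper_space : Prop :=
  forall (x : X) (r : R), compact [set y : X | mdist x y <= r].

Definition separable_space : Prop :=
  exists2 D : set X, countable D & dense D.

End MetricSpaces.

(* [rescaled X r] is the metric space (X, d / r): an alias of X, with its own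
   metricType structure. *)
Definition rescaled (R : realType) (X : metricType R) (r : {posnum R}) : Type :=
  X.

Section Rescaled.
Variables (R : realType) (X : metricType R) (r : {posnum R}).

HB.instance Definition _ := Choice.on (rescaled X r).

Definition rescaled_dist (x y : rescaled X r) : R :=
  mdist (x : X) (y : X) / r%:num.

Lemma rescaled_distxx x : rescaled_dist x x = 0.
Proof. by rewrite /rescaled_dist mdistxx mul0r. Qed.

Lemma rescaled_dist_positivity x y : rescaled_dist x y = 0 -> x = y.
Proof.
move=> /(congr1 ( *%R^~ r%:num)); rewrite mul0r divfK ?gt_eqF //.
exact: mdist_positivity.
Qed.

Lemma rescaled_dist_sym x y : rescaled_dist x y = rescaled_dist y x.
Proof. by rewrite /rescaled_dist metric_sym. Qed.

Lemma rescaled_dist_triangle y x z :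
  rescaled_dist x z <= rescaled_dist x y + rescaled_dist y z.
Proof.
by rewrite /rescaled_dist -mulrDl ler_pM2r ?invr_gt0 // metric_triangle.
Qed.

HB.instance Definition _ := isMetric.Build R (rescaled X r)
  rescaled_distxx rescaled_dist_positivity
  rescaled_dist_sym rescaled_dist_triangle.

End Rescaled.

(* f is an e-isometry from A to B, both with the restricted distances. The
   map f is total, but only its values on A matter. *)
Definition eps_isometry (R : realType) (X Y : metricType R) (e : R)
    (A : set X) (B : set Y) (f : X -> Y) : Prop :=
  [/\ forall z, A z -> B (f z),
      forall z w, A z -> A w -> `|mdist z w - mdist (f z) (f w)| <= e &
      forall b, B b -> exists2 a, A a & mdist (f a) b <= e].

Definition pGH_realized (R : realType) (X : nat -> metricType R)
    (x : forall i, X i) (Y : metricType R) (y : Y)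
    (eps rad : nat -> R) (f : forall i, X i -> Y) : Prop :=
  [/\ eps i @[i --> \oo] --> (0 : R),
      rad i @[i --> \oo] --> +oo,
      forall i, eps_isometry (eps i) (ball (x i) (rad i)) (ball y (rad i)) (f i)
    & forall i, f i (x i) = y].

Definition pGH_converges (R : realType) (X : nat -> metricType R)
    (x : forall i, X i) (Y : metricType R) (y : Y) : Prop :=
  exists (eps rad : nat -> R) (f : forall i, X i -> Y),
    pGH_realized x y eps rad f.

(* (Y, y) \in Tan(X, d, x). *)
Definition tangent_space (R : realType) (X : metricType R) (x : X)
    (Y : metricType R) (y : Y) : Prop :=
  exists2 r : nat -> {posnum R}, (r i)%:num @[i --> \oo] --> (0 : R) &
    @pGH_converges R (fun i => rescaled X (r i)) (fun=> x) Y y.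

(* The space Gamma(X). The underlying function is total; its values outside
   the domain are never used. *)
Record bilip_curve (R : realType) (X : metricType R) := BilipCurve {
  Dom : set R ;
  curve :> R -> X ;
  Dom_nonempty : Dom !=set0 ;
  Dom_compact : compact Dom ;
  curve_bilip : exists2 L : R, 0 < L & forall s t, Dom s -> Dom t ->
    L^-1 * `|s - t| <= mdist (curve s) (curve t) <= L * `|s - t|
}.

Definition density_one (R : realType) (A : set R) (x : R) : Prop :=
  (lebesgue_measure (A `&` ball x r)
     * (fine (lebesgue_measure (ball x r)))^-1%:E)%E
    @[r --> (0 : R)^'+] --> (1%:E : \bar R).

Definition shrinks_nicely (R : realType) (E : nat -> set R) (t : R) : Prop :=
  (forall i, measurable (E i)) /\
  exists (r : nat -> R) (alpha : R),
    [/\ forall i, 0 < r i, 0 < alpha,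
        forall i, E i `<=` ball t (r i) &
        forall i, (alpha%:E * lebesgue_measure (ball t (r i))
                     <= lebesgue_measure (E i))%E].

Definition segment (R : realType) (a b : R) : set R :=
  [set u | Num.min a b <= u <= Num.max a b].

Section MetricDifferentiability.
Variables (R : realType) (X : metricType R) (gamma : bilip_curve X).

(* Terms with s i = tau i, where the quotient is meaningless, do not occur:
   sets that shrink nicely have positive measure. *)
Definition is_metric_derivative (t l : R) : Prop :=
  forall s tau : nat -> R,
    s i @[i --> \oo] --> (0 : R) -> tau i @[i --> \oo] --> (0 : R) ->
    (forall i, Dom gamma (t + s i) /\ Dom gamma (t + tau i)) ->
    shrinks_nicely (fun i => segment (t + s i) (t + tau i)) t ->
    mdist (gamma (t + s i)) (gamma (t + tau i)) / `|s i - tau i|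
      @[i --> \oo] --> l.

Definition metric_differentiable (t : R) : Prop :=
  Dom gamma t /\ exists l : R, is_metric_derivative t l.

(* |d gamma|(t), with a default value where gamma is not metric
   differentiable. *)
Definition metric_derivative (t : R) : R := xget 0 (is_metric_derivative t).

End MetricDifferentiability.

Definition is_line (R : realType) (Y : metricType R) (L : set Y) : Prop :=
  exists2 phi : R -> Y, (forall s t, mdist (phi s) (phi t) = `|s - t|) &
    L = range phi.

(* Membership of gamma (r i * t) in the ball on which f i is an eps i-isometry
   makes explicit that f i is evaluated on its domain. *)
Definition is_limit_of_curve (R : realType) (X : metricType R) (x : X)
    (Y : metricType R) (y : Y) (gamma : bilip_curve X) (L : set Y) : Prop :=
  exists (lambda : R -> Y) (c : R),
    [/\ 0 < c, forall t s, mdist (lambda t) (lambda s) = c * `|t - s|,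
        L = range lambda &
    exists (r : nat -> {posnum R}) (eps rad : nat -> R)
           (f : forall i, rescaled X (r i) -> Y) (D : set R),
      [/\ (r i)%:num @[i --> \oo] --> (0 : R),
          @pGH_realized R (fun i => rescaled X (r i)) (fun=> x) Y y eps rad f,
          dense D &
          forall t, D t ->
            (\forall i \near \oo, Dom gamma ((r i)%:num * t) /\
               ball (x : rescaled X (r i)) (rad i) (gamma ((r i)%:num * t))) /\
            f i (gamma ((r i)%:num * t)) @[i --> \oo] --> lambda t]].

(* Main.v *)
(** By a Borel-Cantelli argument, density one at 0 gives a subsequence of the
    scales [r i] along which almost every [t] eventually satisfies
    [r i * t \in Dom gamma]; fix a countable dense set of such [t].  Along a
    further subsequence the images of [gamma (r i * t)] in the tangent space
    converge for all these [t] at once, by properness.  For distinct [s], [t]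
    the segments with endpoints [r i * s] and [r i * t] shrink nicely to 0, so
    metric differentiability makes the limit map multiply distances by
    [|d gamma|(0)], and by properness it extends from the dense set to [R]. *)
Require Import Defs.
From mathcomp Require Import all_boot all_order all_algebra.
From mathcomp Require Import all_classical all_reals all_analysis.
From mathcomp Require Import measurable_realfun ring lra.

Import Order.TTheory GRing.Theory Num.Theory.
Import numFieldNormedType.Exports.
Local Open Scope classical_set_scope.
Local Open Scope ring_scope.

(** * Density points under dilation *)

Lemma lebesgue_measure_dilation {R : realType} {r : R} {A : set R} :
  0 < r -> measurable A ->
  (lebesgue_measure ( *%R r @^-1` A) = r^-1%:E * lebesgue_measure A)%E.
Proof.
move=> r0 mA.
have mr : measurable_fun [set: measurableTypeR R]
    ( *%R r : measurableTypeR R -> measurableTypeR R).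
  exact: mulrl_measurable.
have [nu nuE] : exists nu : {measure set (measurableTypeR R) -> \bar R},
    forall B, nu B = lebesgue_measure ( *%R r @^-1` B).
  by unshelve eexists (pushforward (@lebesgue_measure R)
    ( *%R r : _ -> measurableTypeR R)).
(* Uniqueness of Lebesgue measure: [r] times the pushforward [nu] gives each half-open interval its
   length. *)
have -> : lebesgue_measure A = mscale (NngNum (ltW r0)) nu A.
  apply: lebesgue_measure_unique => // _ [[a b]] _ <-.
  rewrite -[RHS]/(r%:E * nu _)%E nuE.
  have -> : *%R r @^-1` `]a, b] = `]a / r, b / r]%classic.
    by apply/seteqP; split => x /=; rewrite !in_itv/= ltr_pdivrMr//
      ler_pdivlMr// ![x * r]mulrC.
  rewrite !lebesgue_measure_itv /= !lte_fin ltr_pM2r ?invr_gt0//.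
  case: ifP => _; last by rewrite mule0.
  by rewrite -!EFinD -EFinM -mulrBl mulrC divfK// lt0r_neq0.
by rewrite -[mscale _ _ _]/(r%:E * nu _)%E nuE muleA -EFinM mulVf ?mul1e// lt0r_neq0.
Qed.

Lemma density_one_complement {R : realType} {A : set R} {x d : R} :
  measurable A -> density_one A x -> 0 < d ->
  \forall r \near (0 : R)^'+,
    (lebesgue_measure (ball x r `\` A) <= (d * r)%:E)%E.
Proof.
move=> mA dA d0.
(* The ball has measure [2 * r], so missing less than the fraction [d / 2] of it means missing less
   than [d * r]. *)
have d1 : ((1 - d / 2)%:E < 1%:E :> \bar R)%E.
  by rewrite lte_fin ltrBlDr ltrDl divr_gt0.
have near_dA : \forall r \near (0 : R)^'+, ((1 - d / 2)%:E <
    lebesgue_measure (A `&` ball x r) *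
    ((fine (lebesgue_measure (ball x r)))^-1)%:E)%E.
  exact: dA _ (open_ereal_gt' d1).
near=> r.
have r0 : 0 < r by near: r; exact: nbhs_right_gt.
have mb : measurable (ball x r) by exact: measurable_ball.
have : ((1 - d / 2)%:E < lebesgue_measure (A `&` ball x r) *
    ((fine (lebesgue_measure (ball x r)))^-1)%:E)%E by near: r.
rewrite lebesgue_measure_ball ?(ltW r0)//.
have finb : (lebesgue_measure (ball x r) < +oo)%E.
  by rewrite lebesgue_measure_ball ?(ltW r0)// ltry.
have finAb : (lebesgue_measure (A `&` ball x r) < +oo)%E.
  by apply: le_lt_trans finb; apply: le_measure; rewrite ?inE//;
    apply: measurableI.
have -> : lebesgue_measure (ball x r `\` A) =
    (lebesgue_measure (ball x r) - lebesgue_measure (A `&` ball x r))%E.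
  by rewrite setIC; exact: measureD.
rewrite lebesgue_measure_ball ?(ltW r0)//.
have : (lebesgue_measure (A `&` ball x r) \is a fin_num).
  by rewrite ge0_fin_numE.
move=> /fineK <- /=. rewrite -EFinM -EFinB lte_fin lee_fin.
have -> : r *+ 2 = 2 * r by rewrite mulr_natl.
rewrite ltr_pdivlMr ?mulr_gt0// => h; nra.
Unshelve. all: by end_near. Qed.

(** The scale [r (phi k)] is chosen so small that, after dilation, the part of the ball of radius
    [k.+1] outside [A] has measure at most [1 / 2 ^ (k + 1)]. These bounds are summable, so almost
    every [t] lies in only finitely many of these exceptional sets. *)
Lemma dense_blowup_subsequence {R : realType} {A : set R}
    {r : nat -> {posnum R}} :
  measurable A -> density_one A 0 -> (r i)%:num @[i --> \oo] --> (0 : R) ->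
  exists2 phi : nat -> nat, (forall k, (k <= phi k)%N) &
    dense [set t : R | \forall k \near \oo, A ((r (phi k))%:num * t)].
Proof.
move=> mA dA r0.
have /choice[phi Hphi] : forall k, exists i, (k <= i)%N /\
    (lebesgue_measure (ball (0%R : R) ((r i)%:num * k.+1%:R) `\` A) <=
       ((r i)%:num * (1 / (2 ^ (k + 1))%:R))%:E)%E.
  move=> k.
  (* The density estimate is applied at radius [r i * k.+1]; the factor [k.+1^-1] cancels the growth
     of the ball. *)
  pose d : R := k.+1%:R^-1 * (1 / (2 ^ (k + 1))%:R).
  have d0 : 0 < d by rewrite /d mulr_gt0// ?divr_gt0// ?ltr0n ?expn_gt0.
  have [e /= e0 He] := density_one_complement mA dA d0.
  have re : \forall i \near \oo, (r i)%:num * k.+1%:R < e.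
    have e1 : 0 < e / k.+1%:R by rewrite divr_gt0.
    move/cvgrPdist_lt : r0 => /(_ _ e1); apply: filterS => i /=.
    by rewrite sub0r normrN gtr0_norm// ltr_pdivlMr.
  near \oo => i.
  exists i; split; first by near: i; exact: nbhs_infty_ge.
  have -> : (r i)%:num * (1 / (2 ^ (k + 1))%:R) =
      d * ((r i)%:num * k.+1%:R).
    rewrite /d; set n : R := k.+1%:R; set c := 1 / _.
    have n0 : n != 0 by rewrite pnatr_eq0.
    by field.
  apply: He; last by rewrite mulr_gt0.
  by rewrite /ball_ /= sub0r normrN gtr0_norm ?mulr_gt0//; near: i.
exists phi; first by move=> k; have [] := Hphi k.
(* The exceptional set at stage [k]: those [t] with [|t| < k.+1] whose dilate misses [A]. *)
pose F k := *%R (r (phi k))%:num @^-1`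
  (ball (0%R : R) ((r (phi k))%:num * k.+1%:R) `\` A).
have mF0 k : measurable (ball (0%R : R) ((r (phi k))%:num * k.+1%:R) `\` A).
  by apply: measurableD => //; exact: measurable_ball.
have mF k : measurable (F k).
  have mr : measurable_fun [set: R] ( *%R (r (phi k))%:num : R -> R).
    exact: mulrl_measurable.
  by rewrite -[F k]setTI; exact: mr.
have muF k : (lebesgue_measure (F k) <= (1 / (2 ^ (k + 1))%:R)%:E)%E.
  rewrite lebesgue_measure_dilation//.
  have [_ h] := Hphi k.
  apply: (@le_trans _ _ (((r (phi k))%:num)^-1%:E *
    ((r (phi k))%:num * (1 / (2 ^ (k + 1))%:R))%:E)%E).
    by apply: lee_wpmul2l h; rewrite lee_fin.
  by rewrite -EFinM mulKf ?lexx//.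
have F0 : lebesgue_measure (lim_sup_set F) = 0%E.
  apply: lim_sup_set_cvg0 => //.
  apply: (@le_lt_trans _ _
    (\sum_(0 <= n <oo) (1 / (2 ^ (n + 1))%:R : R)%:E)%E).
    by apply: lee_nneseries => [i _ _|i _]; [exact: measure_ge0|exact: muF].
  have := @cvg_geometric_eseries_half R 1 0.
  by move/cvg_lim => ->//; rewrite ltry.
move=> O [x Ox] oO.
have /nbhs_ballP[e /= e0 eO] := open_nbhs_nbhs (conj oO Ox).
suff [t /= xt Ft] : exists2 t, ball x e t & ~ lim_sup_set F t.
  exists t; split; first exact: eO.
  have [n nFt] : exists n, forall j, (n <= j)%N -> ~ F j t.
    apply: contrapT => h; apply: Ft => n _; apply: contrapT => nt.
    by apply: h; exists n => j nj Fj; apply: nt; exists j.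
  (* Once [k] exceeds [|t|], the ball condition in [F k] holds, so avoiding [F k] forces the dilate
     of [t] into [A]. *)
  rewrite /=; near=> k; apply: contrapT => nA.
  apply: (nFt k); first by near: k; exact: nbhs_infty_ge.
  split => //; rewrite /ball /= sub0r normrN normrM gtr0_norm// ltr_pM2l//.
  apply: (@lt_le_trans _ _ k%:R); last by rewrite ler_nat.
  by near: k; exact: nbhs_infty_gtr.
(* Otherwise a ball of positive measure would lie in a null set. *)
apply: contrapT => h.
have : ball x e `<=` lim_sup_set F.
  by move=> t xt; apply: contrapT => Ft; apply: h; exists t.
have mlim : measurable (lim_sup_set F).
  apply: bigcap_measurable => // k _.
  by apply: bigcup_measurable => j /= _; exact: mF.
move=> xF; have : (lebesgue_measure (ball x e) <=
    lebesgue_measure (lim_sup_set F))%E.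
  by apply: le_measure; rewrite ?inE//; exact: measurable_ball.
rewrite F0 lebesgue_measure_ball ?(ltW e0)//; apply/negP.
by rewrite -ltNge lte_fin pmulrn_lgt0 ?e0.
Unshelve. all: by end_near. Qed.

(** One point of [P] is picked in each rational ball that meets [P]. The default [p] covers the
    other balls and the integers that encode nothing, so every term stays in [P]. *)
Lemma dense_sequence {R : realType} {P : set R} : dense P ->
  exists2 tau : nat -> R, (forall n, P (tau n)) & dense (range tau).
Proof.
move=> dP.
have [p [_ Pp]] : [set: R] `&` P !=set0 by apply: dP; [exists 0|exact: openT].
pose T (c : rat * rat) := xget p (ball (ratr c.1 : R) (ratr c.2) `&` P).
have PT c : P (T c).
  by rewrite /T; case: xgetP => [y _ [_]|_].
pose tau n := if unpickle n is Some c then T c else p.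
exists tau; first by move=> n; rewrite /tau; case: unpickle.
move=> O [x Ox] oO.
have [c [r /= [xB BO]]] := open_subball_rat oO (mem_set Ox).
have [y [By Py]] : ball (ratr c : R) (ratr r) `&` P !=set0.
  apply: dP; [by exists x; exact: set_mem|exact: ball_open].
exists (T (c, r)); split.
  by apply: BO; have [] := xgetPex p
    (ex_intro (ball (ratr c : R) (ratr r) `&` P) y (conj By Py)).
by exists (pickle (c, r)) => //; rewrite /tau pickleK.
Qed.

(** * Subsequential limits and extension from a dense set *)

Lemma mdist_sub {R : realType} {X : metricType R} (x y z : X) :
  `|mdist x z - mdist y z| <= mdist x y.
Proof.
have := metric_triangle x y z; have := metric_triangle y x z.
by rewrite (metric_sym y x) ler_norml => *; apply/andP; split; lra.
Qed.

Lemma mdist_sub2 {R : realType} {X : metricType R} (x y x' y' : X) :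
  `|mdist x y - mdist x' y'| <= mdist x x' + mdist y y'.
Proof.
have := mdist_sub x x' y; have := mdist_sub y y' x'.
rewrite !(metric_sym _ x') !ler_norml => /andP[? ?] /andP[? ?].
by apply/andP; split; lra.
Qed.

Lemma eq_of_dist_lt {R : realType} (a b : R) :
  (forall e, 0 < e -> `|a - b| <= e) -> a = b.
Proof.
move=> h; apply/eqP; rewrite -subr_eq0 -normr_le0.
by apply/ler_addgt0Pr => e e0; rewrite add0r; exact: h.
Qed.

Lemma cvg_leq_infty {phi : nat -> nat} :
  (forall k, (k <= phi k)%N) -> phi k @[k --> \oo] --> \oo.
Proof.
move=> phik A [N _ NA]; exists N => // k /= Nk.
by apply: NA => /=; exact: leq_trans (phik k).
Qed.

(* The limits are taken along one ultrafilter, which handles all [n] at once;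
   countability then turns the ultrafilter into a subsequence. *)
Lemma diagonal_subsequence {R : realType} {Y : metricType R}
    {g : nat -> nat -> Y} :
  (forall n, exists2 K, compact K & \forall i \near \oo, K (g n i)) ->
  exists psi : nat -> nat, (forall k, (k <= psi k)%N) /\
    exists l : nat -> Y, forall n, g n (psi k) @[k --> \oo] --> l n.
Proof.
move=> gK.
have [U [UU sU]] := @ultraFilterLemma nat \oo _.
have PU : ProperFilter U by exact: ultra_proper.
have /choice[l lU] : forall n, exists l, forall e : R, 0 < e ->
    U [set i | mdist l (g n i) < e].
  move=> n; have [K cK Kg] := gK n.
  have [l [_ cl]] := cK (g n @ U) _ (sU _ Kg).
  exists l => e e0.
  (* Otherwise the complement belongs to [U], and the cluster point [l] would have in its [e]-ball a
     point at distance at least [e]. *)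
  have [//|Ue] := in_ultra_setVsetC [set i | mdist l (g n i) < e] UU.
  have [|y [/= ye]] := cl [set y | ~ mdist l y < e] (ball l e) Ue.
    exact: nbhsx_ballx.
  by rewrite ballEmdist.
(* Stage [k] constrains only the first [k.+1] sequences: a finite intersection of members of [U],
   hence non-empty. *)
have /choice[psi Hpsi] : forall k, exists i, (k <= i)%N /\
    forall n : 'I_k.+1, mdist (l n) (g n i) < k.+1%:R^-1.
  move=> k; apply: (@filter_ex _ U).
  apply: filterI; first by apply: sU; exact: nbhs_infty_ge.
  by apply: filter_forall => n; apply: lU.
exists psi; split; first by move=> k; have [] := Hpsi k.
exists l => n; apply/metricType_numDomainType.cvgrPdist_lt => e e0.
near=> k.
have nk : (n < k.+1)%N by rewrite ltnS; near: k; exact: nbhs_infty_ge.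
have [_ /(_ (Ordinal nk))/= /lt_trans] := Hpsi k; apply.
by near: k; exact: (near_infty_natSinv_lt (PosNum e0)).
Unshelve. all: by end_near. Qed.

(** The value at [t] is a cluster point of the [l i] as [tau i] approaches [t], which exists because
    these [l i] stay in a closed ball. Its distances to all [l i] are then forced, and they
    determine the distances between any two values. *)
Lemma dilation_extension {R : realType} {Y : metricType R} {I : Type}
    {tau : I -> R} {l : I -> Y} {c : R} :
  proper_space Y -> 0 <= c -> dense (range tau) ->
  (forall i j, mdist (l i) (l j) = c * `|tau i - tau j|) ->
  exists2 lambda : R -> Y,
    (forall s t, mdist (lambda s) (lambda t) = c * `|s - t|) &
    forall i, lambda (tau i) = l i.
Proof.
move=> Yp c0 dtau lE.
have near_tau t e : 0 < e -> exists i, `|t - tau i| < e.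
  move=> e0; have [] := dtau (ball t e) _ (ball_open _ _).
    by exists t; exact: ballxx.
  by move=> y [ty [i _ iE]]; exists i; rewrite iE.
have /choice[lambda lambdaE] : forall t, exists y,
    forall i, mdist y (l i) = c * `|t - tau i|.
  move=> t.
  pose G := filter_from [set e : R | 0 < e]
    (fun e => [set i | `|t - tau i| < e]).
  have PG : ProperFilter G.
    apply: filter_from_proper; last by move=> e; exact: near_tau.
    apply: filter_from_filter; first by exists 1; rewrite /= ltr01.
    move=> e1 e2 /= e10 e20; exists (Num.min e1 e2).
      by rewrite /= lt_min e10.
    by move=> i /=; rewrite lt_min => /andP[].
  (* Two parameters within 1 of [t] differ by less than 2, whence the radius [c * 2]. *)
  have [i0 ti0] := near_tau t 1 ltr01.
  have [|y [_ cly]] := Yp (l i0) (c * 2) (l @ G) _.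
    exists 1 => [|i /= ti]; first exact: ltr01.
    rewrite lE ler_wpM2l//; apply: le_trans (ler_distD t _ _) _.
    by rewrite (distrC _ t); lra.
  exists y => j; apply: eq_of_dist_lt => e e0.
  have c1 : 0 < c + 1 by lra.
  (* With [d] this quantity, replacing [tau i] by [t] costs [c * d] and replacing [l i] by [y] costs
     [d]. *)
  have d0 : 0 < e / (c + 1) by rewrite divr_gt0.
  have [||y' [[i /= ti <-]]] :=
      cly (l @` [set i | `|t - tau i| < e / (c + 1)]) (ball y (e / (c + 1))).
  - by exists (e / (c + 1)) => //= i ti; exists i.
  - exact: nbhsx_ballx.
  rewrite ballEmdist /= => yi.
  have := mdist_sub y (l i) (l j); rewrite lE.
  have : `|c * `|tau i - tau j| - c * `|t - tau j| | <= c * `|t - tau i|.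
    rewrite -mulrBr normrM ger0_norm// ler_wpM2l//.
    apply: le_trans (ler_dist_dist _ _) _.
    by rewrite opprB addrA subrK distrC.
  have : c * `|t - tau i| <= c * (e / (c + 1)) by rewrite ler_wpM2l// ltW.
  have : c * (e / (c + 1)) + e / (c + 1) = e.
    by field; rewrite gt_eqF.
  rewrite !ler_norml => ? ? /andP[? ?] /andP[? ?].
  by apply/andP; split; lra.
exists lambda => [s t|i]; last first.
  by apply: mdist_positivity; rewrite lambdaE subrr normr0 mulr0.
apply: eq_of_dist_lt => e e0.
(* Replacing [t] by [tau i] costs [c] times this twice; the summand 1 keeps the denominator positive
   when [c = 0]. *)
have d0 : 0 < e / (c + c + 1) by rewrite divr_gt0//; lra.
have [i ti] := near_tau t _ d0.
have := mdist_sub (lambda t) (l i) (lambda s).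
rewrite (metric_sym (l i)) !lambdaE (metric_sym (lambda t)).
have : `|c * `|s - tau i| - c * `|s - t| | <= c * `|t - tau i|.
  rewrite -mulrBr normrM ger0_norm// ler_wpM2l//.
  apply: le_trans (ler_dist_dist _ _) _.
  by rewrite opprB addrC addrA subrK.
have : c * `|t - tau i| <= c * (e / (c + c + 1)) by rewrite ler_wpM2l// ltW.
have : c * (e / (c + c + 1)) *+ 2 + e / (c + c + 1) = e.
  by field; rewrite gt_eqF//; lra.
rewrite !ler_norml => ? ? /andP[? ?] /andP[? ?].
by apply/andP; split; lra.
Qed.

(** * Metric differentiability along dilated parameters *)

Lemma lebesgue_measure_segment {R : realType} (a b : R) :
  lebesgue_measure (segment a b) = `|a - b|%:E.
Proof.
have -> : segment a b = `[Num.min a b, Num.max a b]%classic.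
  by apply/seteqP; split => x; rewrite /segment /= in_itv.
rewrite lebesgue_measure_itv /= lte_fin.
have [ab|ba|->] := ltgtP a b.
- by rewrite ab distrC gtr0_norm ?subr_gt0.
- by rewrite ba gtr0_norm ?subr_gt0.
- by rewrite ltxx subrr normr0.
Qed.

Lemma measurable_segment {R : realType} (a b : R) : measurable (segment a b).
Proof.
have -> : segment a b = `[Num.min a b, Num.max a b]%classic.
  by apply/seteqP; split => x; rewrite /segment /= in_itv.
exact: measurable_itv.
Qed.

Lemma metric_derivative_blowup {R : realType} {X : metricType R}
    {gamma : bilip_curve X} {c : R} {r : nat -> {posnum R}} {s t : R} :
  is_metric_derivative gamma 0 c -> (r i)%:num @[i --> \oo] --> (0 : R) ->
  (\forall i \near \oo, Dom gamma ((r i)%:num * s)) ->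
  (\forall i \near \oo, Dom gamma ((r i)%:num * t)) ->
  mdist (gamma ((r i)%:num * s)) (gamma ((r i)%:num * t)) / (r i)%:num
    @[i --> \oo] --> c * `|s - t|.
Proof.
move=> cE r0 Ds Dt.
have [<-|st] := eqVneq s t.
  rewrite subrr normr0 mulr0; apply: cvg_near_cst; apply: nearW => i.
  by rewrite mdistxx mul0r.
have st0 : 0 < `|s - t| by rewrite normr_gt0 subr_eq0.
(* [is_metric_derivative] asks for domain membership at every index, so the sequences are shifted by
   [N]. *)
have [N _ DN] : \forall i \near \oo,
    Dom gamma ((r i)%:num * s) /\ Dom gamma ((r i)%:num * t).
  by near=> i; split; near: i.
have r0N : (r (i + N)%N)%:num @[i --> \oo] --> (0 : R).
  by rewrite (cvg_shiftn N (fun i => (r i)%:num)).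
have rs0 u : (r (i + N)%N)%:num * u @[i --> \oo] --> (0 : R).
  by rewrite -(mul0r u); apply: cvgMl.
have distE i u v : `|(r i)%:num * u - (r i)%:num * v| = (r i)%:num * `|u - v|.
  by rewrite -mulrBr normrM gtr0_norm.
(* The summand 1 puts the closed segment inside the open ball of radius [r * M]. That ball has
   measure [2 * r * M] and the segment [r * |s - t|], which gives the proportion [|s - t| / (2 * M)]
   below. *)
pose M := `|s| + `|t| + 1.
have M0 : 0 < M by rewrite /M ltr_wpDl// addr_ge0.
suff dE : mdist (gamma (0 + (r (i + N)%N)%:num * s))
    (gamma (0 + (r (i + N)%N)%:num * t)) /
    `|(r (i + N)%N)%:num * s - (r (i + N)%N)%:num * t| @[i --> \oo] --> c.
  rewrite -(cvg_shiftn N (fun i => _ / (r i)%:num)).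
  apply: (cvg_trans _ (cvgM dE (cvg_cst `|s - t|))).
  apply: near_eq_cvg; apply: nearW => i /=.
  by rewrite !add0r distE invfM mulrA divfK ?gt_eqF.
apply: (cE _ _ (rs0 s) (rs0 t)).
- by move=> i; rewrite !add0r; apply: DN; rewrite /= leq_addl.
- split; first by move=> i; exact: measurable_segment.
  exists (fun i => (r (i + N)%N)%:num * M), (`|s - t| / (M *+ 2)); split.
  + by move=> i; rewrite mulr_gt0.
  + by rewrite divr_gt0// pmulrn_lgt0.
  + move=> i u /=; rewrite /segment /ball /= !add0r normrN.
    have ri0 : 0 < (r (i + N)%N)%:num by [].
    have bound v : `|(r (i + N)%N)%:num * v| = (r (i + N)%N)%:num * `|v|.
      by rewrite normrM gtr0_norm.
    have := bound t; have := bound s.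
    move: (ler_norm (- ((r (i + N)%N)%:num * s)))
      (ler_norm ((r (i + N)%N)%:num * s))
      (ler_norm (- ((r (i + N)%N)%:num * t)))
      (ler_norm ((r (i + N)%N)%:num * t)).
    rewrite !normrN ge_min le_max ltr_norml mulrDr mulrDr mulr1.
    move=> ? ? ? ? bs bt.
    have := mulr_ge0 (ltW ri0) (normr_ge0 s).
    have := mulr_ge0 (ltW ri0) (normr_ge0 t).
    by move=> ? ? /andP[/orP[] ? /orP[] ?]; apply/andP; split; lra.
  + move=> i; rewrite lebesgue_measure_segment lebesgue_measure_ball; last first.
      by rewrite mulr_ge0// ltW.
    rewrite !add0r distE -EFinM lee_fin -mulrnAr mulrCA divfK//.
    by rewrite gt_eqF// pmulrn_lgt0.
Unshelve. all: by end_near. Qed.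

(** * Construction of the limit line *)

Lemma rescaled_mdistE {R : realType} {X : metricType R} (r : {posnum R})
    (x y : X) :
  mdist (x : rescaled X r) (y : rescaled X r) = mdist x y / r%:num.
Proof. by []. Qed.

Lemma pGH_realized_subsequence {R : realType} {X : nat -> metricType R}
    {x : forall i, X i} {Y : metricType R} {y : Y} {eps rad : nat -> R}
    {f : forall i, X i -> Y} {phi : nat -> nat} :
  pGH_realized x y eps rad f -> phi k @[k --> \oo] --> \oo ->
  pGH_realized (fun k => x (phi k)) y (eps \o phi) (rad \o phi)
    (fun k => f (phi k)).
Proof.
move=> [eps0 radoo fiso fx] phioo; split.
- exact: cvg_comp phioo eps0.
- exact: cvg_comp phioo radoo.
- by move=> k; exact: fiso.
- by move=> k; exact: fx.
Qed.

Theorem proposition3p10 (R : realType) (X : metricType R)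
    (X_complete : complete_space X) (X_proper : proper_space X)
    (X_separable : separable_space X) (x : X)
    (Xoo : metricType R) (xoo : Xoo)
    (Xoo_proper : proper_space Xoo) (Xoo_complete : complete_space Xoo)
    (Xoo_separable : separable_space Xoo)
    (Xoo_tangent : tangent_space x xoo)
    (gamma : bilip_curve X)
    (Dom0 : Dom gamma 0) (gamma0 : gamma 0 = x)
    (density0 : density_one (Dom gamma) 0)
    (gamma_diff : metric_differentiable gamma 0)
    (gamma_speed : 0 < metric_derivative gamma 0) :
  exists2 L : set Xoo, is_line L & is_limit_of_curve x xoo gamma L.
Proof.
have [r r0 [eps [rad [f fGH]]]] := Xoo_tangent.
have mDom : measurable (Dom gamma).
  by apply: compact_measurable; exact: Dom_compact.
have [phi phi_ge dD] := dense_blowup_subsequence mDom density0 r0.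
have [tau tauD dtau] := dense_sequence dD.
have [_ [c0 c0E]] := gamma_diff.
(* Differentiability rules out the default value of [xget]. *)
have : is_metric_derivative gamma 0 (metric_derivative gamma 0).
  by apply: (@xgetPex _ 0 (is_metric_derivative gamma 0)); exists c0.
move: (metric_derivative gamma 0) gamma_speed => c c_gt0 cE.
have [L L0 gammaL] := curve_bilip gamma.
have phioo := cvg_leq_infty phi_ge.
have fGHphi := pGH_realized_subsequence fGH phioo.
have [epsphi0 radphioo fiso fx] := fGHphi.
have rphi0 : (r (phi k))%:num @[k --> \oo] --> (0 : R).
  exact: cvg_comp phioo r0.
pose p n k : rescaled X (r (phi k)) := gamma ((r (phi k))%:num * tau n).
pose fp n k := f (phi k) (p n k).
(* The Lipschitz bound is invariant under rescaling, so for fixed [n] the points [p n k] stay at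
   bounded distance from [x] while the radii tend to infinity. *)
have dist_xp n k : Dom gamma ((r (phi k))%:num * tau n) ->
    mdist (x : rescaled X (r (phi k))) (p n k) <= L * `|tau n|.
  move=> Dk; rewrite rescaled_mdistE ler_pdivrMr// -gamma0.
  have /andP[_] := gammaL _ _ Dom0 Dk.
  by rewrite sub0r normrN normrM gtr0_norm// -mulrA (mulrC `|_|).
have p_ball n : \forall k \near \oo, Dom gamma ((r (phi k))%:num * tau n) /\
    ball (x : rescaled X (r (phi k))) (rad (phi k)) (p n k).
  near=> k.
  have Dk : Dom gamma ((r (phi k))%:num * tau n) by near: k; exact: tauD.
  split=> //; rewrite ballEmdist /= (le_lt_trans (dist_xp _ _ Dk))//.
  by near: k; exact: (cvgry_gt radphioo).
have dist_fp n m : \forall k \near \oo,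
    `|mdist (p n k) (p m k) - mdist (fp n k) (fp m k)| <= eps (phi k).
  apply: filterS (filterI (p_ball n) (p_ball m)) => k [[_ pn] [_ pm]].
  by have [_ fd _] := fiso k; exact: fd.
have fp_compact n :
    exists2 K : set Xoo, compact K & \forall k \near \oo, K (fp n k).
  (* The approximate isometry sends [x] to [xoo] and eventually distorts distances by less than
     1. *)
  exists [set y | mdist xoo y <= L * `|tau n| + 1]; first exact: Xoo_proper.
  near=> k => /=.
  have [Dk pk] : Dom gamma ((r (phi k))%:num * tau n) /\
      ball (x : rescaled X (r (phi k))) (rad (phi k)) (p n k) by near: k.
  have rad0 : 0 < rad (phi k) by near: k; exact: (cvgry_gt radphioo).
  have eps1 : eps (phi k) < 1 by near: k; exact: (cvgr_lt _ epsphi0 _ ltr01).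
  have [_ fd _] := fiso k.
  have := fd _ _ (ballxx _ rad0) pk; rewrite fx -/(fp n k) /=.
  by have := dist_xp _ _ Dk; rewrite ler_norml => ? /andP[? ?]; lra.
have [psi [psi_ge [l fp_l]]] := diagonal_subsequence fp_compact.
have psioo := cvg_leq_infty psi_ge.
have ldist n m : mdist (l n) (l m) = c * `|tau n - tau m|.
  apply: eq_of_dist_lt => e e0.
  (* Four errors: the differential quotient, the two limits [l n] and [l m], and the distortion of
     [f]. *)
  have e4 : 0 < e / 4 by rewrite divr_gt0.
  have speed : \forall k \near \oo,
      `|c * `|tau n - tau m| - mdist (p n (psi k)) (p m (psi k))| < e / 4.
    have := metric_derivative_blowup cE rphi0 (tauD n) (tauD m).
    by move/cvgrPdist_lt => /(_ _ e4) /psioo.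
  have near_l i : \forall k \near \oo, mdist (l i) (fp i (psi k)) < e / 4.
    by have /metricType_numDomainType.cvgrPdist_lt/(_ _ e4) := fp_l i.
  have eps4 : \forall k \near \oo, eps (phi (psi k)) < e / 4.
    exact: (psioo _ (cvgr_lt _ epsphi0 _ e4)).
  have [k [[[sk nk] mk] [ek dk]]] := filter_ex
    (filterI (filterI (filterI speed (near_l n)) (near_l m))
       (filterI eps4 (psioo _ (dist_fp n m)))).
  move: sk nk mk ek dk => /=.
  have := mdist_sub2 (l n) (l m) (fp n (psi k)) (fp m (psi k)).
  rewrite !ler_norml !ltr_norml => /andP[? ?] /andP[? ?] ? ? ? /andP[? ?].
  by apply/andP; split; lra.
have [lambda lambdaE lambda_tau] :=
  dilation_extension Xoo_proper (ltW c_gt0) dtau ldist.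
exists (range lambda).
  (* Unit-speed reparametrization; it has the same range because [c] is positive. *)
  exists (fun s => lambda (s / c)) => [s t|].
    by rewrite lambdaE -mulrBl normrM (gtr0_norm (x := c^-1)) ?invr_gt0//
      mulrCA divff ?mulr1// gt_eqF.
  apply/seteqP; split=> y [t _ <-].
    by exists (t * c) => //; rewrite mulfK// gt_eqF.
  by exists (t / c).
exists lambda, c; split=> //.
exists (fun k => r (phi (psi k))), (eps \o phi \o psi), (rad \o phi \o psi).
exists (fun k => f (phi (psi k))), (range tau); split=> //.
- exact: cvg_comp psioo rphi0.
- exact: pGH_realized_subsequence fGHphi psioo.
- move=> _ [n _ <-]; split; first exact: (psioo _ (p_ball n)).
  by rewrite lambda_tau; exact: fp_l.
Unshelve. all: by end_near. Qed.
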